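(* Let $(X_i)_{i\in\mathbb{Z}}$ be a stationary process with values in a countable set $\mathbb{W}$. Then for every $n\in\mathbb{N}$, $$\frac{v(n|2)}{n}\le -\sum_{m=1}^{n-1} m\,\Delta^2 v(n-m+1).$$
   Context: A stationary process is a sequence $(X_i)_{i\in\mathbb{Z}}$ of random variables such that for every $k\ge 1$ and $i\in\mathbb{Z}$ the tuple $(X_{i+1},\ldots,X_{i+k})$ has the same distribution as $(X_1,\ldots,X_k)$. For integers $n\ge 0$, $v(n):=\mathbf{E}\,\#\{X_1,X_2,\ldots,X_n\}$ is the expected number of distinct values (types) among $X_1,\ldots,X_n$, with $v(0)=0$. For $k\ge 1$, $v(n|k)$ is the expected number of $w\in\mathbb{W}$ such that $\#\{i\in\{1,\ldots,n\}:X_i=w\}=k$, i.e. the expected number of types occurring exactly $k$ times among $X_1,\ldots,X_n$. The difference operator is $\Delta f(n):=f(n)-f(n-1)$, so $\Delta^2 v(n)=v(n)-2v(n-1)+v(n-2)$. Here $\mathbb{N}=\{1,2,\ldots\}$ and an empty sum is $0$. *)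

(* Defs.v *)
From HB Require Import structures.
From mathcomp Require Import all_boot all_order all_algebra.
From mathcomp Require Import finmap.
From mathcomp Require Import all_classical all_reals all_analysis.

Set Implicit Arguments.
Unset Strict Implicit.
Unset Printing Implicit Defensive.

Import Order.TTheory GRing.Theory Num.Theory.

Local Open Scope classical_set_scope.
Local Open Scope ring_scope.

(* (X_{i+1}, ..., X_{i+k}); 'I_k is numbered from 0, whence the successor. *)
Definition block d d' (T : measurableType d) (W : measurableType d')
    (X : int -> T -> W) (i : int) (k : nat) (t : T) : k.-tuple W :=
  [tuple X (i + (j : nat).+1%:Z) t | j < k].

(* Equality of laws on the product sigma-algebra of W^k. *)
Definition stationary d d' (T : measurableType d) (W : measurableType d')
    (R : realType) (P : probability T R) (X : int -> {RV P >-> W}) : Prop :=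
  forall (k : nat) (i : int), (1 <= k)%N ->
  forall A : set (k.-tuple W), measurable A ->
    pushforward P (@block _ _ T W X i k) A =
    pushforward P (@block _ _ T W X 0 k) A.

(* #{X_1, ..., X_n} *)
Definition num_types d d' (T : measurableType d) (W : measurableType d')
    (X : int -> T -> W) (n : nat) (t : T) : nat :=
  size (undup (block X 0 n t)).

(* #{w in W : #{i in {1, ..., n} : X_i = w} = k}. For k >= 1 this set of w is
   finite; [fset_set] is the empty set on infinite sets, so the value is only
   meaningful for k >= 1. *)
Definition num_types_occ d d' (T : measurableType d) (W : measurableType d')
    (X : int -> T -> W) (n k : nat) (t : T) : nat :=
  #|` fset_set [set w : W | count_mem w (block X 0 n t) = k] |.

(* [fine] is harmless in the next two definitions when W is countable with all
   subsets measurable: both counts are then measurable and bounded by n (for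
   k >= 1 in the second one), so the expectations are finite. *)
Definition v d d' (T : measurableType d) (W : measurableType d')
    (R : realType) (P : probability T R) (X : int -> {RV P >-> W})
    (n : nat) : R :=
  fine ('E_P[fun t : T => (@num_types _ _ T W X n t)%:R : R]).

Definition v_occ d d' (T : measurableType d) (W : measurableType d')
    (R : realType) (P : probability T R) (X : int -> {RV P >-> W})
    (n k : nat) : R :=
  fine ('E_P[fun t : T => (@num_types_occ _ _ T W X n k t)%:R : R]).

(* On nat, meaningful for n >= 1 only (and n >= 2 when iterated twice). *)
Definition Delta (R : realType) (f : nat -> R) (n : nat) : R :=
  f n - f n.-1.

(* Main.v *)
(* Summation by parts turns the right-hand side into n v(1) - v(n) = n - v(n).
   Pointwise, each type occurring twice uses up one index more than the one that
   counts it in #{X_1, ..., X_n}, so v(n|2) + v(n) <= n, and v(n|2) / n <= v(n|2). *)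

Require Import Defs.
From HB Require Import structures.
From mathcomp Require Import all_boot all_order all_algebra.
From mathcomp Require Import finmap ring.
From mathcomp Require Import all_classical all_reals all_analysis.

Set Implicit Arguments.
Unset Strict Implicit.
Unset Printing Implicit Defensive.

Import Order.TTheory GRing.Theory Num.Theory.

Local Open Scope classical_set_scope.
Local Open Scope ring_scope.

(** Grouping entries by value makes all three terms sums over [undup s]. A value of multiplicity c
    contributes c on the right and 1 + [c = 2] on the left, and c is positive. *)
Lemma size_undup_card_count2 (W : choiceType) (s : seq W) :
  (#|` fset_set [set w | count_mem w s = 2%N]| + size (undup s) <= size s)%N.
Proof.
(* The set is exhibited as finite, since [fset_set] is empty on infinite sets. *)
have -> : [set w | count_mem w s = 2%N] =
    [set` [fset w in [seq w <- s | count_mem w s == 2%N]]%fset].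
  apply/seteqP; split=> w /=; rewrite !inE mem_filter.
    by move=> s2; rewrite s2 eqxx -has_pred1 has_count s2.
  by move=> /andP[/eqP].
rewrite set_fsetK card_fseq -filter_undup size_filter -sum1_size -sum1_count.
(* [s] is a permutation of constant blocks, one per value, whose lengths are the multiplicities. *)
rewrite -(perm_size (perm_count_undup s)) size_flatten /shape -map_comp sumnE.
rewrite big_map big_mkcond -big_split/= big_seq [leqRHS]big_seq.
apply: leq_sum => w; rewrite mem_undup -has_pred1 has_count size_nseq.
by case: eqP => [->|].
Qed.

(** Induction on [n]: shifting [m] by one splits the weight m + 1 into m, which gives the previous
    sum, and 1, which telescopes. All arguments [n - m + 1] are at least 2, so [Delta] never meets
    the predecessor of 0. *)
Lemma sum_mul_Delta2 (R : realType) (f : nat -> R) (n : nat) :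
  (1 <= n)%N -> f 0%N = 0 ->
  \sum_(1 <= m < n) m%:R * Delta (Delta f) (n - m + 1)%N = f n - n%:R * f 1%N.
Proof.
move=> n1 f0; elim: n n1 => // -[_ _|n IHn _]; first by rewrite big_geq// mul1r subrr.
(* The arguments descend from [n.+2] to 2; reversing the index makes the telescope ascend. *)
have tele : \sum_(0 <= m < n.+1) Delta (Delta f) (n.+1 - m + 1)%N =
    Delta f n.+2 - Delta f 1.
  rewrite big_nat_rev/= -telescope_sumr// [RHS]big_add1/=.
  apply: eq_big_nat => i /andP[_ iln].
  by rewrite add0n subSS subSn ?leq_subr// subKn// addn1.
rewrite big_add1/= (eq_bigr (fun m => m%:R * Delta (Delta f) (n.+1 - m + 1)%N +
    Delta (Delta f) (n.+1 - m + 1)%N)); last first.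
  by move=> m _; rewrite subSS -natr1 mulrDl mul1r.
(* The m = 0 term vanishes, leaving the sum of the induction hypothesis. *)
rewrite big_split/= tele big_ltn// mul0r add0r IHn// /Delta/= f0.
rewrite -[n.+2%:R]natr1.
ring.
Qed.

(** No condition on [g] is imposed: the preimage is a countable union of slices on which the head
    has a fixed value [w], and on each slice [g (w :: _)] is again an arbitrary function of the
    tail. *)
Lemma measurable_fun_seq (R : realType) d d' (T : measurableType d)
    (W : measurableType d') (I : Type) (X : I -> T -> W) (g : seq W -> R)
    (s : seq I) :
  countable [set: W] -> @measurable d' W = discrete_measurable ->
  (forall i, measurable_fun setT (X i)) ->
  measurable_fun setT (fun t => g [seq X i t | i <- s]).
Proof.
move=> cW dW mX; elim: s g => [|i s IHs] g /=; first exact: measurable_cst.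
move=> _ B mB; rewrite setTI.
have -> : (fun t => g (X i t :: [seq X j t | j <- s])) @^-1` B =
  \bigcup_w (X i @^-1` [set w] `&`
    (fun t => g (w :: [seq X j t | j <- s])) @^-1` B).
  by apply/seteqP; split=> t /= => [Bt|[w _ [<-]]//]; exists (X i t).
apply: countable_bigcupT_measurable => // w; apply: measurableI.
  by rewrite -[X in measurable X]setTI; apply: mX => //; rewrite dW.
by rewrite -[X in measurable X]setTI; apply: (IHs (fun u => g (w :: u))).
Qed.

(** Supplies the integrability that keeps expectations of counts finite and additive. *)
Lemma bounded_nat_Lfun1 (R : realType) d (T : measurableType d)
    (P : probability T R) (f : T -> nat) (n : nat) :
  measurable_fun setT (fun t => (f t)%:R : R) -> (forall t, (f t <= n)%N) ->
  (fun t => (f t)%:R : R) \in Lfun P 1.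
Proof.
move=> mf fn; apply/Lfun1_integrable; apply: measurable_bounded_integrable => //.
  by apply: (le_lt_trans (probability_le1 P measurableT)); rewrite ltry.
exists n%:R; split=> // M nM t _; rewrite /= ger0_norm//.
by apply: (le_trans _ (ltW nM)); rewrite ler_nat.
Qed.

Theorem proposition30 (R : realType) (d d' : measure_display)
    (T : measurableType d) (P : probability T R)
    (W : measurableType d') (W_countable : countable [set: W])
    (W_discrete : @measurable d' W = discrete_measurable)
    (X : int -> {RV P >-> W}) (X_stationary : stationary X)
    (n : nat) (n_ge1 : (1 <= n)%N) :
  v_occ X n 2 / n%:R <=
  - \sum_(1 <= m < n) m%:R * Delta (Delta (v X)) (n - m + 1)%N.
Proof.
have types0 t : num_types X 0 t = 0%N.
  by rewrite /num_types (tuple0 (block _ _ _ _)).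
have types1 t : num_types X 1 t = 1%N.
  by rewrite /num_types; case: (tupleP (block X 0 1 t)) => w s; rewrite (tuple0 s).
(* The values at 0 and 1 are the boundary data of [sum_mul_Delta2]. *)
have v0 : v X 0 = 0.
  by rewrite /v; under eq_fun do rewrite types0; rewrite expectation_cst.
have v1 : v X 1 = 1.
  by rewrite /v; under eq_fun do rewrite types1; rewrite expectation_cst.
(* [block] unfolds to a map over the enumeration of ['I_n]. *)
have mblock (g : seq W -> R) : measurable_fun setT (fun t => g (block X 0 n t)).
  exact: measurable_fun_seq.
have le_n t : (num_types_occ X n 2 t + num_types X n t <= n)%N.
  by rewrite -[leqRHS](size_tuple (block X 0 n t)) size_undup_card_count2.
have Lo : (fun t => (num_types_occ X n 2 t)%:R : R) \in Lfun P 1.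
  apply: (@bounded_nat_Lfun1 _ _ _ _ _ n) => [|t].
    exact: (mblock (fun s => #|` fset_set [set w | count_mem w s = 2%N]|%:R)).
  exact: leq_trans (leq_addr _ _) (le_n t).
have Lt : (fun t => (num_types X n t)%:R : R) \in Lfun P 1.
  apply: (@bounded_nat_Lfun1 _ _ _ _ _ n) => [|t].
    exact: (mblock (fun s => (size (undup s))%:R)).
  exact: leq_trans (leq_addl _ _) (le_n t).
have vo_le : v_occ X n 2 + v X n <= n%:R.
  (* Both expectations merge into one, so that [le_n] can be integrated against the constant [n]. *)
  rewrite -fineD ?expectation_fin_num// -expectationD//.
  rewrite -lee_fin fineK ?expectation_fin_num ?rpredD//.
  rewrite -(expectation_cst P n%:R) expectation_le//.
  - exact: (mblock (fun s => (#|` fset_set [set w | count_mem w s = 2%N]|%:R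
      + (size (undup s))%:R : R))).
  - by move=> t; rewrite /= addr_ge0.
  - by apply: aeW => t; rewrite /= -natrD ler_nat.
rewrite sum_mul_Delta2// v1 mulr1 opprB lerBrDr (le_trans _ vo_le)// lerD2r.
rewrite ler_piMr//.
  by apply: fine_ge0; apply: expectation_ge0 => t.
by rewrite invf_le1 ?ltr0n// ler1n.
Qed.
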